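(* Let $B=\|b_{ij}\|_{i,j=1}^n$ be a real $n\times n$ matrix that is anti-bidiagonal with positive entries, that is, $$b_{ij}>0\ \text{ if } i+j=n+1 \text{ or } i+j=n+2,\qquad b_{ij}=0\ \text{ otherwise.}$$ Then $B$ possesses a self-interlacing spectrum.
   Context: An $n\times n$ matrix possesses a self-interlacing spectrum if its eigenvalues are real and simple and can be enumerated as $\lambda_1,\ldots,\lambda_n$ so that $\lambda_1>-\lambda_2>\lambda_3>\cdots>(-1)^{n-1}\lambda_n>0$. The anti-bidiagonal matrix has first row $(0,\ldots,0,* )$, second row $(0,\ldots,0,*,* )$, third row $(0,\ldots,0,*,*,0)$, and so on, down to the last row $( *,*,0,\ldots,0)$, where each $*$ denotes an arbitrary positive number (the entries need not be symmetric); exactly one of these nonzero entries lies on the main diagonal. *)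

(* Defs.v *)
From HB Require Import structures.
From mathcomp Require Import all_boot all_order all_algebra.
From mathcomp Require Import complex.
From mathcomp Require Import reals.

Set Implicit Arguments.
Unset Strict Implicit.
Unset Printing Implicit Defensive.

Import Order.TTheory GRing.Theory Num.Theory.

Local Open Scope ring_scope.

(* Indices in 'I_n are 0-based: i.+1 and j.+1 are the usual row and column. *)
Definition positive_anti_bidiagonal (R : numDomainType) (n : nat)
    (B : 'M[R]_n) : Prop :=
  forall i j : 'I_n,
    let on_band := ((i.+1 + j.+1 == n.+1) || (i.+1 + j.+1 == n.+2))%N in
    (on_band -> 0 < B i j) /\ (~~ on_band -> B i j = 0).

Definition complexify (R : rcfType) (n : nat) (A : 'M[R]_n) : 'M[R[i]]_n :=
  map_mx (real_complex R) A.

Definition real_spectrum (R : rcfType) (n : nat) (A : 'M[R]_n) : Prop :=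
  forall z : R[i], eigenvalue (complexify A) z -> complex.Im z = 0.

(* Simplicity is algebraic: multiplicity 1 in the characteristic polynomial. *)
Definition simple_spectrum (R : rcfType) (n : nat) (A : 'M[R]_n) : Prop :=
  forall z : R[i], eigenvalue (complexify A) z ->
    mup z (char_poly (complexify A)) = 1%N.

Definition enumerates_spectrum (R : rcfType) (n : nat) (A : 'M[R]_n)
    (lambda : 'I_n -> R) : Prop :=
  injective lambda /\
  forall z : R[i], eigenvalue (complexify A) z <->
    exists i : 'I_n, z = real_complex R (lambda i).

(* lambda i is the eigenvalue of 1-based index i.+1, whence its sign is
   (-1) ^+ i; the last clause concerns the final index i = n - 1 only. *)
Definition self_interlacing (R : rcfType) (n : nat)
    (lambda : 'I_n -> R) : Prop :=
  (forall i j : 'I_n, j = i.+1 :> nat ->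
     (-1) ^+ j * lambda j < (-1) ^+ i * lambda i) /\
  (forall i : 'I_n, i.+1 = n -> 0 < (-1) ^+ i * lambda i).

Definition self_interlacing_spectrum (R : rcfType) (n : nat)
    (A : 'M[R]_n) : Prop :=
  [/\ real_spectrum A, simple_spectrum A &
      exists lambda : 'I_n -> R,
        enumerates_spectrum A lambda /\ self_interlacing lambda].

(* Main.v *)
(* Deleting the first index of an anti-bidiagonal matrix and reversing the order
   of the others gives a matrix of the same kind, so the characteristic
   polynomials satisfy p_(k+1) = x p_k - c_k p_(k-1) with p_0 = 1, p_1 = x - a
   and a, c_k > 0.  As for Jacobi matrices, p_n has simple real roots
   x_0 > x_1 > ... > x_(n-1), at which p_(n-1) alternates in sign.  The
   polynomials (-1)^k p_k(-x) satisfy the same recurrence, so their Wronskian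
   with the p_k, namely p_n(x) p_(n-1)(-x) + p_n(-x) p_(n-1)(x) up to sign, is a
   constant (-1)^n C with C > 0.  Hence (-1)^n p_n(-x), whose roots are the
   -x_i, also alternates in sign at the x_i, which forces
   x_0 > -x_(n-1) > x_1 > -x_(n-2) > ...: the required enumeration is
   x_0, x_(n-1), x_1, x_(n-2), ... *)
Require Import Defs.
From HB Require Import structures.
From mathcomp Require Import all_boot all_order all_algebra.
From mathcomp Require Import complex.
From mathcomp Require Import reals.
From mathcomp Require Import perm polyrcf zify ring lra.

Set Implicit Arguments.
Unset Strict Implicit.
Unset Printing Implicit Defensive.

Import Order.TTheory GRing.Theory Num.Theory.

Local Open Scope ring_scope.

(** * Signs and roots of monic real polynomials *)

Lemma monic_uniq_roots (R : fieldType) (p : {poly R}) (s : seq R) :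
  p \is monic -> size p = (size s).+1 -> uniq s -> all (root p) s ->
  p = \prod_(z <- s) ('X - z%:P).
Proof.
move=> /monicP p_monic szp uniq_s roots_s.
rewrite {1}(all_roots_prod_XsubC szp roots_s) ?p_monic ?scale1r //.
by rewrite uniq_rootsE.
Qed.

Lemma monic_pos_pinfty (R : realFieldType) (p : {poly R}) :
  p \is monic -> exists M, forall t, M <= t -> 0 < p.[t].
Proof.
move=> /monicP p1; have [|M HM] := @poly_pinfty_gt_lc R p; first by rewrite p1.
by exists M => t /HM; apply: lt_le_trans; rewrite p1.
Qed.

(** Reflection turns [p] into [(-1)^n p(-x)], again monic, and exchanges the two infinities. *)
Lemma monic_sign_minfty (R : realFieldType) (p : {poly R}) (n : nat) :
  p \is monic -> size p = n.+1 ->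
  exists M, forall t, t <= M -> 0 < (-1) ^+ n * p.[t].
Proof.
move=> p_monic szp; have [|M HM] := @monic_pos_pinfty R ((-1) ^+ n *: (p \Po -'X)).
  rewrite monicE lead_coefZ lead_coef_comp ?size_polyN ?size_polyX //.
  rewrite (monicP p_monic) lead_coefN lead_coefX mul1r szp -exprMn mulrNN.
  by rewrite mulr1 expr1n.
exists (- M) => t; rewrite lerNr => /HM.
by rewrite hornerZ horner_comp hornerN hornerX opprK.
Qed.

Lemma horner_prod_XsubC (R : comNzRingType) (s : seq R) (t : R) :
  (\prod_(z <- s) ('X - z%:P)).[t] = \prod_(z <- s) (t - z).
Proof. by rewrite horner_prod; apply: eq_bigr => z _; rewrite hornerXsubC. Qed.

Lemma sorted_gt_uniq (R : realDomainType) (s : seq R) : sorted >%R s -> uniq s.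
Proof. by apply: sorted_uniq; [exact: rev_trans lt_trans | exact: ltxx]. Qed.

(* The sign of [g] at -oo continues the alternation, so that the [N] points
   bound [N] gaps. *)
Lemma alternating_roots (R : rcfType) (g : {poly R}) (N : nat) (y : nat -> R) :
  g \is monic -> size g = N.+1 ->
  (forall i, (i.+1 < N)%N -> y i.+1 < y i) ->
  (forall i, (i < N)%N -> 0 < (-1) ^+ i * g.[y i]) ->
  exists s : seq R, [/\ size s = N, sorted >%R s, g = \prod_(z <- s) ('X - z%:P),
    forall i, (i < N)%N -> s`_i < y i &
    forall i, (i.+1 < N)%N -> y i.+1 < s`_i].
Proof.
move=> g_monic szg ydec ysgn.
have [M HM] := monic_sign_minfty g_monic szg.
pose m := Num.min M (y N.-1 - 1).
pose y' i := if (i < N)%N then y i else m.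
have y'dec i : (i < N)%N -> y' i.+1 < y' i.
  move=> iN; rewrite /y' iN; case: ifP => [/ydec //|iN1].
  have -> : i = N.-1 by lia.
  by rewrite /m gt_min; apply/orP; right; lra.
have y'sgn i : (i <= N)%N -> 0 < (-1) ^+ i * g.[y' i].
  rewrite leq_eqVlt /y' => /orP[/eqP->|iN]; last by rewrite iN ysgn.
  by rewrite ltnn HM // ge_min lexx.
have root_ex (i : 'I_N) : exists r, (y' i.+1 < r < y' i) && root g r.
  have := y'sgn i (ltnW (ltn_ord i)); have := y'sgn i.+1 (ltn_ord i).
  rewrite exprS mulN1r mulNr => s1 s0.
  have [||r r_in r_root] := @poly_ivtoo R g (y' i.+1) (y' i).
  - exact/ltW/y'dec.
  - have := mulr_gt0 s1 s0.
    by rewrite mulNr mulrACA -expr2 sqrr_sign mul1r oppr_gt0.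
  by exists r; rewrite r_root andbT; move: r_in; rewrite in_itv.
have [f Hf] := fin_all_exists root_ex.
pose s := [seq f i | i <- enum 'I_N].
have szs : size s = N by rewrite size_map size_enum_ord.
have snth i (iN : (i < N)%N) : s`_i = f (Ordinal iN).
  rewrite (nth_map (Ordinal iN)) ?size_enum_ord //; congr f.
  by apply: val_inj; rewrite /= nth_enum_ord.
have s_lt i : (i < N)%N -> s`_i < y' i.
  by move=> iN; rewrite (snth _ iN); have /andP[/andP[]] := Hf (Ordinal iN).
have s_gt i : (i < N)%N -> y' i.+1 < s`_i.
  by move=> iN; rewrite (snth _ iN); have /andP[/andP[]] := Hf (Ordinal iN).
have s_sorted : sorted >%R s.
  apply/(sortedP 0) => i; rewrite szs => iN.
  by apply: lt_trans (s_lt _ iN) (s_gt _ _); rewrite ltnW.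
exists s; split=> //.
(* The [N] gaps are disjoint, so their roots are distinct and exhaust the degree of [g]. *)
- apply: monic_uniq_roots; rewrite ?szs ?sorted_gt_uniq //.
  by apply/allP => _ /mapP[i _ ->]; case/andP: (Hf i).
- by move=> i iN; have := s_lt i iN; rewrite /y' iN.
- by move=> i iN; have := s_gt i (ltnW iN); rewrite /y' iN.
Qed.

(** Exactly the first [k] factors are negative. *)
Lemma prod_sub_sign (R : realDomainType) (s : seq R) (k : nat) (t : R) :
  (k <= size s)%N ->
  (forall j, (j < k)%N -> t < s`_j) ->
  (forall j, (k <= j < size s)%N -> s`_j < t) ->
  0 < (-1) ^+ k * \prod_(z <- s) (t - z).
Proof.
elim: s k => [|z s IHs] [|k] //=.
- by move=> _ _ _; rewrite big_nil mulr1.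
- move=> _ _ gt_t; rewrite expr0 mul1r big_cons mulr_gt0 //.
    by rewrite subr_gt0 (gt_t 0).
  rewrite -[X in 0 < X]mul1r -(expr0 (-1)); apply: IHs => // j js.
  exact: (gt_t j.+1).
rewrite ltnS => ks lt_t gt_t.
rewrite exprS big_cons mulrACA mulr_gt0 //.
  by rewrite mulN1r opprB subr_gt0 (lt_t 0).
by apply: IHs => // j js; [apply: (lt_t j.+1) | apply: (gt_t j.+1)].
Qed.

(** * Roots of polynomials given by the three-term recurrence *)

(* [p] and [q] are consecutive terms, [p] of degree [m.+1], of the sequence
   1, 'X - a, ..., p_(k+1) = 'X p_k - c_k p_(k-1) with [a] and the [c_k]
   positive. *)
Inductive jacobi_pair (R : realFieldType) : nat -> {poly R} -> {poly R} -> Prop :=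
| jacobi_pair0 a : 0 < a -> jacobi_pair 0 ('X - a%:P) 1
| jacobi_pairS m c p q : 0 < c -> jacobi_pair m p q ->
    jacobi_pair m.+1 ('X * p - c *: q) p.

(* The discrete Wronskian of the sequences p_k(t) and (-1)^k p_k(-t), which
   satisfy the same recurrence. *)
Lemma jacobi_wronskian (R : realFieldType) (m : nat) (p q : {poly R}) :
  jacobi_pair m p q ->
  exists2 C, 0 < C & forall t, p.[t] * q.[- t] + p.[- t] * q.[t] = (-1) ^+ m.+1 * C.
Proof.
elim=> {m p q} [a a_gt0|m c p q c_gt0 _ [C C_gt0 HC]].
  by exists (2 * a) => [|t]; [lra | rewrite expr1 !hornerXsubC !hornerC; ring].
(* The terms in [t p(t) p(-t)] cancel, leaving [-c] times the previous Wronskian. *)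
exists (c * C) => [|t]; first exact: mulr_gt0.
rewrite exprS -mulrA (mulrCA _ c) -(HC t) !(hornerD, hornerN, hornerZ, hornerM, hornerX); ring.
Qed.

Lemma jacobi_pair_size (R : realFieldType) (m : nat) (p q : {poly R}) :
  jacobi_pair m p q ->
  [/\ p \is monic, size p = m.+2 & size q = m.+1].
Proof.
elim=> {m p q} [a _|m c p q _ _ [p_monic szp szq]].
  by rewrite monicXsubC size_XsubC size_poly1.
have szXp : size ('X * p) = m.+3.
  by rewrite mulrC size_mulX ?monic_neq0 // szp.
have szcq : (size (- (c *: q)%R) < size ('X * p)%R)%N.
  by rewrite size_polyN szXp; apply: (leq_ltn_trans (size_scale_leq _ _)); rewrite szq.
by rewrite monicE lead_coefDl // size_polyDl // lead_coefM lead_coefX mul1r.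
Qed.

(** Induction on the recurrence: the alternation of [q] at the roots of [p] makes the roots of the
    next polynomial interlace those of [p], and this interlacing gives the alternation of [p] at the
    new roots. *)
Lemma jacobi_roots (R : rcfType) (m : nat) (p q : {poly R}) :
  jacobi_pair m p q ->
  exists s : seq R, [/\ size s = m.+1, sorted >%R s,
    p = \prod_(z <- s) ('X - z%:P) &
    forall i, (i <= m)%N -> 0 < (-1) ^+ i * q.[s`_i]].
Proof.
elim=> {m p q} [a a_gt0|m c p q c_gt0 Hpq [s [szs s_sorted ps q_sgn]]].
  exists [:: a]; split; rewrite ?big_seq1 // => -[] // _.
  by rewrite expr0 hornerC mul1r.
have [] := jacobi_pair_size (jacobi_pairS c_gt0 Hpq).
set g := 'X * p - c *: q => g_monic szg _.
have [M HM] := monic_pos_pinfty g_monic.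
(* The roots of [p], shifted by one index to make room for a point to their right where [g] is
   positive. *)
pose y i := if i is i'.+1 then s`_i' else Num.max M (s`_0 + 1).
have sdec i : (i < m)%N -> s`_i.+1 < s`_i.
  by move=> im; move/(sortedP 0): s_sorted => /(_ i); apply; rewrite szs.
have root_s i : (i <= m)%N -> p.[s`_i] = 0.
  by move=> im; apply/rootP; rewrite ps root_prod_XsubC mem_nth ?szs.
have [||s' [szs' s'_sorted gs' s'_lt s'_gt]] :=
    @alternating_roots R g m.+2 y g_monic szg.
- move=> [|i] /= im; last exact: sdec.
  by rewrite lt_max; apply/orP; right; lra.
- move=> [|i] im; first by rewrite mul1r HM // le_max lexx.
  (* At a root of [p] the value of [g] is [-c q]; the minus sign matches the index shift in [y]. *)
  rewrite /= !hornerE root_s // mulr0 add0r exprS mulN1r mulrNN mulrCA.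
  by rewrite mulr_gt0 // q_sgn.
exists s'; split=> // i im.
have sle i1 i2 : (i1 <= i2 <= m)%N -> s`_i2 <= s`_i1.
  move=> /andP[]; rewrite leq_eqVlt => /orP[/eqP-> //|lt12] le2.
  rewrite ltW //; apply: (sorted_ltn_nth (rev_trans lt_trans)) => //;
    by rewrite inE szs; lia.
(* Exactly [i] roots of [p] lie above the new root of index [i]. *)
rewrite ps horner_prod_XsubC; apply: prod_sub_sign; first by rewrite szs.
- move=> j ji; have := s'_lt i im; case: i ji im => [//|i] ji im /lt_le_trans.
  by apply; apply: sle; lia.
- move=> j; rewrite szs => /andP[ij jm].
  have im' : (i.+1 < m.+2)%N by lia.
  apply: (le_lt_trans _ (s'_gt i im')); apply: sle; lia.
Qed.

Lemma sorted_gt_prod_XsubC_inj (R : realFieldType) (s t : seq R) :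
  sorted >%R s -> sorted >%R t ->
  \prod_(z <- s) ('X - z%:P) = \prod_(z <- t) ('X - z%:P) -> s = t.
Proof.
move=> s_sorted t_sorted /prod_XsubC_eq/perm_mem.
exact: (irr_sorted_eq (rev_trans lt_trans) ltxx).
Qed.

Lemma jacobi_self_interlacing (R : rcfType) (m : nat) (p q : {poly R}) :
  jacobi_pair m p q ->
  exists s : seq R, [/\ size s = m.+1, uniq s, p = \prod_(z <- s) ('X - z%:P),
    forall i, (i <= m)%N -> - s`_(m - i) < s`_i &
    forall i, (i < m)%N -> s`_i.+1 < - s`_(m - i)].
Proof.
move=> Hpq; have [C C_gt0 HC] := jacobi_wronskian Hpq.
have [p_monic szp _] := jacobi_pair_size Hpq.
have [s [szs s_sorted ps q_sgn]] := jacobi_roots Hpq.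
(* The negated roots, reversed so as to decrease; they are the roots of [(-1)^(m+1) p(-x)]. *)
pose u := rev [seq - z | z <- s].
have szu : size u = m.+1 by rewrite size_rev size_map.
have u_sorted : sorted >%R u.
  by rewrite rev_sorted sorted_map; apply: sub_sorted s_sorted => x z /=; rewrite ltrN2.
pose g := \prod_(z <- u) ('X - z%:P).
have gE t : g.[t] = (-1) ^+ m.+1 * p.[- t].
  rewrite /g ps !horner_prod_XsubC (perm_big _ (permEl (perm_rev _))) big_map.
  rewrite -szs -[RHS]mulr1; elim: (s) => [|z r IHr] /=; first by rewrite !big_nil !mulr1.
  rewrite !big_cons IHr exprS; ring.
have root_s i : (i <= m)%N -> p.[s`_i] = 0.
  by move=> im; apply/rootP; rewrite ps root_prod_XsubC mem_nth ?szs.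
have sdec i : (i < m)%N -> s`_i.+1 < s`_i.
  by move=> im; move/(sortedP 0): s_sorted => /(_ i); apply; rewrite szs.
have [||||r [szr r_sorted gr r_lt r_gt]] := @alternating_roots R g m.+1 (nth 0 s).
- exact: monic_prod_XsubC.
- by rewrite size_prod_XsubC szu.
- by move=> i; rewrite ltnS => /sdec.
- move=> i; rewrite ltnS => im; rewrite gE.
  (* At a root of [p] the Wronskian reduces to [p(-t) q(t)]. Multiplying the goal by the positive
     [(-1)^i q(t)] therefore leaves only squared signs and [C]. *)
  have qi := q_sgn i im; rewrite -(pmulr_lgt0 _ qi).
  have := HC s`_i; rewrite root_s // mul0r add0r => HCi.
  rewrite [X in 0 < X](_ : _ = ((-1) ^+ i) ^+ 2 * (((-1) ^+ m.+1) ^+ 2 * C)).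
    by rewrite !sqrr_sign !mul1r.
  rewrite expr2 -[X in _ = _ * X]mulrA -HCi; ring.
(* Both [r] and [u] are decreasing lists of the roots of [g], hence equal. *)
have uE i : (i <= m)%N -> r`_i = - s`_(m - i).
  move=> im; rewrite -(sorted_gt_prod_XsubC_inj u_sorted r_sorted gr).
  by rewrite nth_rev size_map szs // subSS (nth_map 0) // szs; lia.
exists s; split=> //; first exact: sorted_gt_uniq.
- by move=> i im; rewrite -uE // r_lt.
- by move=> i im; rewrite -uE ?r_gt // ltnW.
Qed.

(** * Characteristic polynomials of anti-bidiagonal matrices *)

Lemma char_poly_perm (R : comNzRingType) (n : nat) (s : 'S_n) (B : 'M[R]_n) :
  char_poly (\matrix_(i, j) B (s i) (s j)) = char_poly B.
Proof.
rewrite /char_poly.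
have -> : char_poly_mx (\matrix_(i, j) B (s i) (s j)) =
    row_perm s (col_perm s (char_poly_mx B)).
  by apply/matrixP => i j; rewrite !mxE (inj_eq perm_inj).
rewrite row_permE col_permE !det_mulmx !det_perm mulrCA.
by rewrite odd_permV -signr_addb addbb mulr1.
Qed.

(* Without the reversal, the second band would lie above the antidiagonal. *)
Definition drop_rev (R : Type) (n : nat) (B : 'M[R]_n.+1) : 'M[R]_n :=
  \matrix_(i, j) B (lift ord0 (rev_ord i)) (lift ord0 (rev_ord j)).

Lemma drop_rev_positive (R : numDomainType) (n : nat) (B : 'M[R]_n.+1) :
  positive_anti_bidiagonal B -> positive_anti_bidiagonal (drop_rev B).
Proof.
move=> hB i j /=; rewrite mxE.
have := hB (lift ord0 (rev_ord i)) (lift ord0 (rev_ord j)); rewrite /= /bump /=.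
set b1 := _ || _; set b2 := _ || _; suff -> : b1 = b2 by [].
have := ltn_ord i; have := ltn_ord j; rewrite /b1 /b2; lia.
Qed.

(** The reversal permutes rows and columns simultaneously, so only the deletion affects the
    characteristic polynomial. *)
Lemma char_poly_drop_rev (R : comNzRingType) (n : nat) (B : 'M[R]_n.+1) :
  char_poly (drop_rev B) = \det (row' ord0 (col' ord0 (char_poly_mx B))).
Proof.
rewrite -[LHS](char_poly_perm (perm (@rev_ord_inj n))); congr (\det _).
apply/matrixP => i j; rewrite !mxE !permE !rev_ordK.
by rewrite (inj_eq lift_inj).
Qed.

(** In the first row of ['X - B] only the two end entries survive. The minor of the last one has a
    single nonzero entry in its first column, at the bottom, and is expanded along that column. *)
Lemma char_poly_recurrence (R : numDomainType) (n : nat) (B : 'M[R]_n.+2) :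
  positive_anti_bidiagonal B ->
  char_poly B = 'X * char_poly (drop_rev B) -
    (B ord0 ord_max * B ord_max ord0) *: char_poly (drop_rev (drop_rev B)).
Proof.
move=> hB.
have B0 (i j : 'I_n.+2) : (i + j != n.+1)%N -> (i + j != n.+2)%N -> B i j = 0.
  by move=> ij1 ij2; apply: (hB i j).2; lia.
pose M := char_poly_mx B.
have M0 (i j : 'I_n.+2) : i != j -> (i + j != n.+1)%N -> (i + j != n.+2)%N ->
    M i j = 0.
  by move=> ij ij1 ij2; rewrite !mxE (negPf ij) B0 // mulr0n subr0.
rewrite char_poly_drop_rev -/M /char_poly -/M (expand_det_row M ord0).
rewrite big_ord_recl big_ord_recr /= big1 => [|i _]; last first.
  by rewrite M0 ?mul0r //= /bump /=; have := ltn_ord i; lia.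
rewrite add0r; congr (_ + _).
  by rewrite /cofactor expr0 mul1r !mxE /= B0 // subr0.
have -> : lift ord0 ord_max = ord_max :> 'I_n.+2 by apply: val_inj.
have ME i j : row' ord0 (col' ord_max M) i j = M (lift ord0 i) (lift ord_max j).
  by rewrite [LHS]mxE [LHS]mxE.
rewrite /cofactor (expand_det_col _ ord0) big_ord_recr /= big1 => [|i _]; last first.
  by rewrite ME M0 ?mul0r // -?val_eqE /= /bump /=; have := ltn_ord i; lia.
rewrite add0r /cofactor.
set M1 := (X in _ ^+ _ * \det X).
have -> : M1 = char_poly_mx (drop_rev (drop_rev B)).
  (* The two reversals cancel: what remains is [B] without its first and last indices, in the
     original order. *)
  have liftl (i : 'I_n) : lift ord0 (lift ord_max i) =
      lift ord0 (rev_ord (lift ord0 (rev_ord i))).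
    by apply: val_inj; rewrite /= /bump; have := ltn_ord i; lia.
  have liftr (i : 'I_n) : lift ord_max (lift ord0 i) =
      lift ord0 (rev_ord (lift ord0 (rev_ord i))).
    by apply: val_inj; rewrite /= /bump; have := ltn_ord i; lia.
  apply/matrixP => i j; rewrite !mxE !liftl liftr (inj_eq lift_inj).
  by rewrite (inj_eq rev_ord_inj) (inj_eq lift_inj) (inj_eq rev_ord_inj).
rewrite !mxE /=.
have -> : lift ord0 ord_max = ord_max :> 'I_n.+2 by apply: val_inj.
have -> : lift ord_max ord0 = ord0 :> 'I_n.+2 by apply: val_inj.
(* The cofactor signs [(-1)^(n+1)] and [(-1)^n] multiply to [-1], while the signs of the two entries
   cancel. *)
rewrite !sub0r -mul_polyC polyCM exprS addn0.
move: (\det _) (B _ _)%:P (B _ _)%:P => d b c.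
rewrite !mulN1r !(mulNr, mulrN) opprK (mulrCA b) (mulrA _ _ (b * d)) -expr2.
by rewrite sqrr_sign mul1r mulrA.
Qed.

Lemma anti_bidiagonal_jacobi (R : realFieldType) (n : nat) (B : 'M[R]_n.+1) :
  positive_anti_bidiagonal B -> jacobi_pair n (char_poly B) (char_poly (drop_rev B)).
Proof.
elim: n B => [|n IHn] B hB.
  rewrite {2}/char_poly det_mx00 /char_poly det_mx11 !mxE mulr1n.
  by apply: jacobi_pair0; apply: (hB ord0 ord0).1.
rewrite char_poly_recurrence //; apply: jacobi_pairS; last exact/IHn/drop_rev_positive.
apply: mulr_gt0; first by apply: (hB ord0 ord_max).1 => /=; lia.
by apply: (hB ord_max ord0).1 => /=; lia.
Qed.

(** * From real roots to the self-interlacing spectrum *)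

Lemma spectrum_of_prod (R : rcfType) (n : nat) (A : 'M[R]_n) (lambda : 'I_n -> R) :
  injective lambda -> char_poly A = \prod_i ('X - (lambda i)%:P) ->
  [/\ real_spectrum A, simple_spectrum A & enumerates_spectrum A lambda].
Proof.
move=> lambda_inj chA.
pose s := [seq real_complex R (lambda i) | i <- enum 'I_n].
have chC : char_poly (complexify A) = \prod_(z <- s) ('X - z%:P).
  rewrite /complexify -map_char_poly chA map_prod_XsubC big_map.
  by rewrite big_enum.
have eigE z : eigenvalue (complexify A) z = (z \in s).
  by rewrite eigenvalue_root_char chC root_prod_XsubC.
split=> [z|z|].
- by rewrite eigE => /mapP[i _ ->].
- rewrite eigE chC mu_prod_XsubC => zs; rewrite count_uniq_mem ?zs //.
  by rewrite map_inj_uniq ?enum_uniq // => i j /complexI/lambda_inj.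
- split=> // z; rewrite eigE; split=> [/mapP[i _ ->]|[i ->]]; first by exists i.
  by apply/mapP; exists i; rewrite ?mem_enum.
Qed.

(** The signed values decrease to a positive one, so they are the absolute values, which are thus
    distinct. *)
Lemma self_interlacing_inj (R : rcfType) (n : nat) (lambda : 'I_n -> R) :
  self_interlacing lambda -> injective lambda.
Proof.
case: n lambda => [|n] lambda [dec last_gt0]; first by move=> -[].
pose a k := (-1) ^+ k * lambda (inord k).
have aE (i : 'I_n.+1) : a i = (-1) ^+ i * lambda i by rewrite /a inord_val.
have adec k : (k < n)%N -> a k.+1 < a k.
  move=> kn; have := dec (inord k) (inord k.+1).
  by rewrite !inordK ?ltnS ?(ltnW kn) //; apply.
have alt i j : (i < j <= n)%N -> a j < a i.
  elim: j => [|j IHj]; first by lia.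
  rewrite ltnS => /andP[]; rewrite leq_eqVlt => /orP[/eqP-> /adec //|ij jn].
  by apply: lt_trans (adec j jn) (IHj _); lia.
have a_gt0 i : (i <= n)%N -> 0 < a i.
  have an : 0 < a n by have := last_gt0 ord_max erefl; rewrite -aE.
  rewrite leq_eqVlt => /orP[/eqP->//|i_n]; apply: lt_trans an (alt _ _ _); lia.
have norm_a (i : 'I_n.+1) : a i = `|lambda i|.
  by rewrite -[LHS]gtr0_norm ?a_gt0 -1?ltnS // aE normrMsign.
move=> i j eq_ij; apply: val_inj; apply/eqP.
have : a i = a j by rewrite !norm_a eq_ij.
have := ltn_ord i; have := ltn_ord j; rewrite !ltnS => jn i_n.
by case: ltngtP => // [ij|ji]; [have := alt i j | have := alt j i];
  rewrite ?ij ?ji ?jn ?i_n => /(_ isT) + eq_a; rewrite eq_a ltxx.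
Qed.

Theorem theorem2p12 (R : realType) (n : nat) (B : 'M[R]_n)
    (hB : positive_anti_bidiagonal B) :
  self_interlacing_spectrum B.
Proof.
suff [lambda [chB lambda_si]] : exists lambda : 'I_n -> R,
    char_poly B = \prod_i ('X - (lambda i)%:P) /\ self_interlacing lambda.
  have lambda_inj := self_interlacing_inj lambda_si.
  have [? ? ?] := spectrum_of_prod lambda_inj chB.
  by split=> //; exists lambda.
case: n B hB => [|m] B hB.
  exists (fun=> 0); split; last by split=> [[]|[]].
  by rewrite big_ord0 /char_poly det_mx00.
have [s [szs s_uniq chs s_gt s_lt]] :=
  jacobi_self_interlacing (anti_bidiagonal_jacobi hB).
(* Even positions take the roots from the top of [s], odd positions from the bottom. *)
pose idx k := if odd k then (m - k./2)%N else k./2.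
have idx_lt k : (k < m.+1)%N -> (idx k < m.+1)%N.
  by rewrite /idx; case: ifP => _; lia.
pose lambda (i : 'I_m.+1) := s`_(idx i).
have lambda_si : self_interlacing lambda.
  have par k : k = (odd k + k./2.*2)%N by rewrite odd_double_half.
  split=> [i j ji|i im]; rewrite /lambda /idx.
    have := ltn_ord j; rewrite ji /= exprS -signr_odd uphalf_half.
    case: (odd i) (par i) => /= par_i jm.
      rewrite expr1 !mulN1r opprK mul1r; apply: s_lt; lia.
    rewrite expr0 mulr1 mulN1r mul1r; apply: s_gt; lia.
  (* At the last index the two ends meet: the inequality compares a root with its own negative,
     which fixes its sign. *)
  rewrite -signr_odd; case: (odd i) (par i) => /= par_i.
    have i2 : (i./2 < m)%N by lia.
    have := s_lt _ i2; rewrite (_ : (m - i./2)%N = i./2.+1); last by lia.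
    by rewrite expr1; lra.
  have i2 : (i./2 <= m)%N by lia.
  have := s_gt _ i2; rewrite (_ : (m - i./2)%N = i./2); last by lia.
  by rewrite expr0; lra.
exists lambda; split=> //.
(* Distinctness comes from the interlacing itself; counting [m.+1] distinct roots then replaces a
   proof that [idx] is a permutation. *)
have lambda_inj := self_interlacing_inj lambda_si.
rewrite (_ : \prod_i _ = \prod_(z <- [seq lambda i | i <- enum 'I_m.+1]) ('X - z%:P)).
  apply: monic_uniq_roots.
  - exact: char_poly_monic.
  - by rewrite size_char_poly size_map size_enum_ord.
  - by rewrite map_inj_uniq ?enum_uniq.
  - apply/allP => _ /mapP[i _ ->].
    by rewrite chs root_prod_XsubC mem_nth // szs idx_lt.
by rewrite big_map big_enum.
Qed.
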